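(* Let $b,d,e\in\mathbb{C}$, $r\in\mathbb{N}$, $\mathbf{m}=(m_1,\dots,m_r)\in\mathbb{N}^r$, $m=m_1+\cdots+m_r$, $\mathbf{f}=(f_1,\dots,f_r)\in\mathbb{C}^r$. Suppose $q\in\{0,\ldots,m-1\}$, $b+m-q\notin-\mathbb{N}_0$, and $f_j-b\notin\{m-q-m_j,m-q-m_j+1,\ldots,0\}$ for every index $1\le j\le r$ such that $m-q-m_j\le0$. Then for each $n\in\mathbb{N}$ $${}_{r+3}F_{r+2}\left(\begin{matrix}-n,b,d,\mathbf{f}+\mathbf{m}\\ b+m-q,e,\mathbf{f}\end{matrix}\right)=\frac{(e-d)_n}{(e)_n}\sum_{j=0}^{q}\frac{(-n)_j(-q)_j(d)_jQ^0_m(-j)}{(b+m-q)_{j}(1+d-e-n)_{j}\,j!}$$ $$+\frac{(-1)^{q+1}(-n)_{q+1}(d)_{q+1}(e-d)_{n-q-1}R_{m-q-1}(-q-1)}{(b+m-q)_{q+1}(e)_{n}(m-q-1)!}\;{}_{m-q+2}F_{m-q+1}\left(\begin{matrix}-n+q+1,1,d+q+1,\boldsymbol{\lambda}+q+2\\ b+m+1,2+d+q-e-n,\boldsymbol{\lambda}+q+1\end{matrix}\right),$$ where $\boldsymbol{\lambda}=(\lambda_1,\dots,\lambda_{m-q-1})$ are the roots of $$R_{m-q-1}(t)=\sum_{k=0}^{m}(b)_kC_{k,r}(-1)^k(1-t-k)_{m-q-1},$$ the values $Q_m^0(-j)$ are $$Q_m^0(-j)=\frac{1}{(-q)_j}\sum_{k=0}^{j}(b)_kC_{k,r}(-j)_k(m-q)_{j-k},\qquad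 0\le j\le q,$$ and $$R_{m-q-1}(-q-1)=(-1)^{m-q+1}\sum_{k=0}^{q+1}(b)_kC_{k,r}(-1)^k(k-m)_{m-q-1}.$$ If $n\le q$, the second term on the right-hand side is missing.
   Context: $\mathbb{N}=\{1,2,\dots\}$, $\mathbb{N}_0=\mathbb{N}\cup\{0\}$; $(z)_k=z(z+1)\cdots(z+k-1)$, $(z)_0=1$. ${}_pF_q$ with omitted argument is the value at $z=1$ of the generalized hypergeometric series $\sum_{n\ge0}\frac{(a_1)_n\cdots(a_p)_n}{(b_1)_n\cdots(b_q)_n}\frac{z^n}{n!}$ (here all series terminate); the parameters are assumed such that no denominators in these finite sums vanish (in particular no $f_j$ is a nonpositive integer). A vector in a parameter list stands for the list of its components: $\mathbf{f}+\mathbf{m}$ means $f_1+m_1,\dots,f_r+m_r$; $\boldsymbol{\lambda}+s$ means $\lambda_1+s,\dots,\lambda_{m-q-1}+s$ (an empty list if $m-q-1=0$). The coefficients are $C_{k,r}=\frac{(-1)^k}{k!}\,{}_{r+1}F_r\left(\begin{matrix}-k,\mathbf{f}+\mathbf{m}\\ \mathbf{f}\end{matrix}\right)=\frac{(-1)^k}{k!}\sum_{i=0}^k\frac{(-k)_i}{i!}\prod_{j=1}^r\frac{(f_j+m_j)_i}{(f_j)_i}$ for $0\le k\le m$; in particular $C_{0,r}=1$, $C_{m,r}=1/\prod_{j=1}^r(f_j)_{m_j}$. The polynomial $R_{m-q-1}$ is regarded as a polynomial of degree $m-q-1$, with $R_{m-q-1}(t)=\kappa\prod_{i=1}^{m-q-1}(t-\lambda_i)$,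 $\kappa\ne0$ constant. It has the equivalent form (recalled in the paper from another work of the authors) $R_{m-q-1}(t)=\sum_{k=0}^{m-q-1}\frac{(\mathbf{f}-b-k)_{\mathbf{m}}(b)_{k}}{(\mathbf{f})_{\mathbf{m}}\,k!}(q+1-m)_{k}(b+k+1-t)_{m-q-1-k}$ with $(\mathbf{f}+s)_{\mathbf{m}}=\prod_{j=1}^r(f_j+s)_{m_j}$. *)

(* Defs.v *)
(* MathComp; the complex numbers are R[i] for a realType R. *)
From HB Require Import structures.
From mathcomp Require Import all_boot all_order all_algebra.
From mathcomp Require Import reals complex.

Set Implicit Arguments.
Unset Strict Implicit.
Unset Printing Implicit Defensive.

Import GRing.Theory.
Local Open Scope ring_scope.

(* Rising factorial (z)_k; also used at z : {poly K}. *)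
Definition poch (A : nzRingType) (z : A) (k : nat) : A :=
  \prod_(i < k) (z + i%:R).

Section Hypergeometric.
Variable K : fieldType.
Implicit Types (a b : seq K) (n N k : nat).

Definition hypterm a b k : K :=
  (\prod_(x <- a) poch x k) / ((\prod_(y <- b) poch y k) * (k`!)%:R).

(* The terminating series pFq(-n, a; b; 1): the upper parameter -n is implicit,
   so there is one more upper parameter than entries of a.  By hypF_partial the
   terms of index > n contribute nothing. *)
Definition hypF n a b : K := \sum_(k < n.+1) hypterm (- n%:R :: a) b k.

Lemma poch_opp_nat n k : (n < k)%N -> poch (- n%:R : K) k = 0.
Proof.
by move=> nk; rewrite /poch (bigD1 (Ordinal nk)) //= addNr mul0r.
Qed.

Lemma hypF_partial n N a b : (n <= N)%N ->
  \sum_(k < N.+1) hypterm (- n%:R :: a) b k = hypF n a b.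
Proof.
move=> nN; rewrite /hypF [RHS](big_ord_widen N.+1 (hypterm (- n%:R :: a) b)) //.
rewrite [RHS]big_mkcond; apply: eq_bigr => k _; case: ifPn => //.
by rewrite -leqNgt => nk; rewrite /hypterm big_cons poch_opp_nat // !mul0r.
Qed.

End Hypergeometric.

Section Coefficients.
Variables (K : fieldType) (r : nat) (f : 'I_r -> K) (mv : 'I_r -> nat).

Definition fseq : seq K := [seq f j | j <- enum 'I_r].
Definition fmseq : seq K := [seq f j + (mv j)%:R | j <- enum 'I_r].

Definition Ccoef (k : nat) : K :=
  (-1) ^+ k / (k`!)%:R * hypF k fmseq fseq.

(* The value Q_m^0(-j), as a function of j; meant for j <= q < m. *)
Definition Q0val (b : K) (m q j : nat) : K :=
  (poch (- q%:R) j)^-1 *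
  \sum_(k < j.+1)
     poch b k * Ccoef k * poch (- j%:R) k * poch (m - q)%:R (j - k).

(* The indeterminate t is 'X and the rising factorial is taken in {poly K}. *)
Definition Rpoly (b : K) (m q : nat) : {poly K} :=
  \sum_(k < m.+1)
     (poch b k * Ccoef k * (-1) ^+ k) *: poch (1 - 'X - k%:R) (m - q - 1).

End Coefficients.

(* Main.v *)
(* Write the left side as the sum over i of (-n)_i (d)_i / ((e)_i i!) G(i), where
   G(i) = (b)_i / (b+m-q)_i P(i) and P(i) is the ratio of Pochhammer symbols of
   f+m and f.  Expanding G in Newton's binomial basis and summing each term by
   Chu-Vandermonde expresses this through the alternating differences of G; the
   same step applied to P with (b, b+m-q) in place of (d, e) expresses these
   through the alternating differences of P, which are k! C_k up to sign.  As P
   is a polynomial of degree m, C_k = 0 for k > m, and for j > q the surviving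
   sum is a multiple of R(-j).  Splitting at j = q gives the two terms. *)
Require Import Defs.
From HB Require Import structures.
From mathcomp Require Import all_boot all_order all_algebra.
From mathcomp Require Import reals complex.
From mathcomp Require Import ring zify.

Import Order.TTheory GRing.Theory Num.Theory.
Local Open Scope ring_scope.

(** * Rising factorials and the Chu-Vandermonde sum *)

Section Pochhammer.
Variable A : comNzRingType.
Implicit Types (z : A) (i j k n : nat).

Lemma poch0 z : poch z 0 = 1.
Proof. by rewrite /poch big_ord0. Qed.

Lemma pochS z k : poch z k.+1 = poch z k * (z + k%:R).
Proof. by rewrite /poch big_ord_recr. Qed.

Lemma pochD z j k : poch z (j + k) = poch z j * poch (z + j%:R) k.
Proof.
elim: k => [|k IH]; first by rewrite addn0 poch0 mulr1.
by rewrite addnS !pochS IH natrD; ring.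
Qed.

Lemma pochSl z k : poch z k.+1 = z * poch (z + 1) k.
Proof. by rewrite -add1n pochD pochS poch0 mul1r addr0. Qed.

Lemma poch_reflect z k : poch z k = (-1) ^+ k * poch (1 - z - k%:R) k.
Proof.
elim: k => [|k IH]; first by rewrite !poch0 mulr1.
rewrite pochS pochSl IH -(natr1 k) exprS.
have -> : 1 - z - (k%:R + 1) + 1 = 1 - z - k%:R by ring.
ring.
Qed.

Lemma poch_opp_natE n k : poch (- n%:R : A) k = (-1) ^+ k * (n ^_ k)%:R.
Proof.
elim: k => [|k IH]; first by rewrite poch0 mulr1.
rewrite pochS IH ffactnSr natrM exprS.
have [le_kn|lt_nk] := leqP k n; first by rewrite natrB //; ring.
by rewrite ffact_small // !(mulr0, mul0r).
Qed.

Lemma poch_natS n k : (n`!)%:R * poch (n.+1%:R : A) k = ((n + k)`!)%:R.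
Proof.
elim: k => [|k IH]; first by rewrite poch0 mulr1 addn0.
by rewrite pochS mulrA IH addnS factS natrM -natrD addSn mulrC.
Qed.

(** Denominators are cleared, so the identity lives in any commutative ring. Pascal's rule splits
    the sum for [n.+1] into [c + n] times the sum for [(a, c)] minus [a] times the sum for
    [(a + 1, c + 1)]; by induction both sums equal $(c-a)_n$. *)
Lemma chu_vandermonde (a c : A) n :
  \sum_(i < n.+1) (-1) ^+ i * 'C(n, i)%:R * (poch a i * poch (c + i%:R) (n - i))
  = poch (c - a) n.
Proof.
elim: n a c => [|n IH] a c.
  by rewrite big_ord1 !poch0 bin0 expr0 !mulr1.
pose F i := (-1) ^+ i * 'C(n, i)%:R * (poch a i * poch (c + i%:R) (n.+1 - i)) : A.
pose H i := (-1) ^+ i * 'C(n, i)%:R *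
  (poch (a + 1) i * poch (c + 1 + i%:R) (n - i)) : A.
have -> : \sum_(i < n.+2) (-1) ^+ i * 'C(n.+1, i)%:R
    * (poch a i * poch (c + i%:R) (n.+1 - i))
  = \sum_(i < n.+2) F i - a * \sum_(i < n.+1) H i.
  rewrite big_ord_recl [X in _ = X - _]big_ord_recl -addrA; congr (_ + _).
    by rewrite /F !bin0.
  rewrite mulr_sumr -sumrB; apply: eq_bigr => i _.
  rewrite /F /H lift0 binS subSS natrD exprS pochSl -(natr1 i).
  have -> : c + (i%:R + 1) = c + 1 + i%:R by ring.
  ring.
have -> : \sum_(i < n.+2) F i = (c + n%:R) * \sum_(i < n.+1)
    (-1) ^+ i * 'C(n, i)%:R * (poch a i * poch (c + i%:R) (n - i)).
  rewrite big_ord_recr /= {2}/F bin_small // mulr0 mul0r addr0 mulr_sumr.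
  apply: eq_bigr => i _; rewrite /F subSn ?leq_ord // pochS natrB ?leq_ord //.
  ring.
rewrite /H !IH pochS.
have -> : c + 1 - (a + 1) = c - a by ring.
ring.
Qed.

End Pochhammer.

(** * Alternating differences: inversion, Pochhammer ratios, polynomials *)

Section AlternatingDifferences.
Variable K : numFieldType.
Implicit Types (g : nat -> K) (a c z : K) (p : {poly K}) (i j k n : nat).

Lemma factn_neq0 n : (n`!)%:R != 0 :> K.
Proof. by rewrite pnatr_eq0 -lt0n fact_gt0. Qed.

Lemma poch_opp_nat_bin n k :
  poch (- n%:R : K) k / (k`!)%:R = (-1) ^+ k * 'C(n, k)%:R.
Proof.
by rewrite poch_opp_natE -bin_ffact natrM mulrA mulfK ?factn_neq0.
Qed.

Lemma poch_opp_nat_neq0 n k : (k <= n)%N -> poch (- n%:R : K) k != 0.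
Proof.
move=> le_kn.
by rewrite poch_opp_natE mulf_neq0 ?signr_eq0 // pnatr_eq0 -lt0n ffact_gt0.
Qed.

Lemma poch_neq0_le z i n : (i <= n)%N -> poch z n != 0 -> poch z i != 0.
Proof.
by move=> le_in; rewrite -(subnKC le_in) pochD mulf_eq0 negb_or => /andP[].
Qed.

Lemma poch_neq0 z : (forall i, z != - i%:R) -> forall k, poch z k != 0.
Proof.
move=> hz k; apply/prodf_neq0 => i _.
by rewrite addr_eq0.
Qed.

(** The last [k] factors of $(z)_n$, read backwards with signs changed, form $(1-z-n)_k$. This
    produces the lower parameters containing [- n]. *)
Lemma poch_sub z n k : (k <= n)%N -> poch (1 - z - n%:R) k != 0 ->
  poch z (n - k) = (-1) ^+ k * poch z n / poch (1 - z - n%:R) k.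
Proof.
move=> le_kn nz; apply: (canRL (mulfK nz)).
rewrite -{3}(subnK le_kn) pochD (poch_reflect _ (z + _)).
have -> : 1 - (z + (n - k)%:R) - k%:R = 1 - z - n%:R by rewrite natrB //; ring.
by rewrite mulrCA signrMK.
Qed.

(* [(-1) ^+ n] times the [n]-th forward difference of [g] at [0]. *)
Definition altdiff g n : K :=
  \sum_(i < n.+1) (-1) ^+ i * 'C(n, i)%:R * g i.

Lemma sum_sign_bin n : \sum_(i < n.+1) (-1) ^+ i * 'C(n, i)%:R = (n == 0)%:R :> K.
Proof.
have := exprBn (1 : K) 1 n; rewrite subrr expr0n => ->.
by apply: eq_bigr => i _; rewrite !expr1n !mulr1 mulr_natr.
Qed.

Lemma bin_trinomial n k s : (k <= n)%N ->
  ('C(n, k + s) * 'C(k + s, k) = 'C(n, k) * 'C(n - k, s))%N.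
Proof.
move=> le_kn; have [le_s|lt_s] := leqP (k + s) n; last first.
  by rewrite (bin_small lt_s) [X in _ = (_ * X)%N]bin_small ?muln0 // ltn_subLR.
have le_s' : (s <= n - k)%N by rewrite leq_subRL.
apply/eqP; rewrite -(eqn_pmul2r (fact_gt0 k)) -(eqn_pmul2r (fact_gt0 s)).
rewrite -(eqn_pmul2r (fact_gt0 (n - k - s))); apply/eqP.
have := bin_fact (leq_addr s k); rewrite addKn => fact_ks.
transitivity ('C(n, k + s) * ('C(k + s, k) * (k`! * s`!) * (n - (k + s))`!))%N.
  by rewrite subnDA; ring.
rewrite fact_ks (bin_fact le_s) -(bin_fact le_kn) -(bin_fact le_s'); ring.
Qed.

Lemma sum_bin_shift n k (F : nat -> K) : (k <= n)%N ->
  \sum_(i < n.+1) 'C(i, k)%:R * F i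
  = \sum_(s < (n - k).+1) 'C(k + s, k)%:R * F (k + s)%N.
Proof.
move=> le_kn; rewrite -(big_mkord xpredT (fun i => 'C(i, k)%:R * F i)).
rewrite (big_cat_nat (n := k)) //=; last exact: leqW.
rewrite big1_seq ?add0r; last first.
  by move=> i; rewrite mem_index_iota => /andP[_ lt_ik]; rewrite bin_small ?mul0r.
rewrite -{1}(add0n k) big_addn subSn // big_mkord.
by apply: eq_bigr => s _; rewrite addnC.
Qed.

(** The transform is an involution: after exchanging sums, what multiplies [g l] is an alternating
    row sum of order [i - l], zero unless [l = i]. The range is a fixed [n], not [i], so that sums
    over [i] can later be exchanged with it; the extra binomials vanish. *)
Lemma altdiff_inv g n i : (i <= n)%N ->
  g i = \sum_(j < n.+1) (-1) ^+ j * 'C(i, j)%:R * altdiff g j.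
Proof.
move=> le_in.
transitivity (altdiff (altdiff g) i); last first.
  rewrite /altdiff -(subnKC le_in) -addSn.
  rewrite big_split_ord /= -[LHS]addr0; congr (_ + _).
  rewrite big1 // => j _; rewrite bin_small ?mulr0 ?mul0r //.
  by rewrite /= addSn ltnS leq_addr.
rewrite /altdiff.
under eq_bigr => j _.
  rewrite (big_ord_widen i.+1 (fun l => (-1) ^+ l * 'C(j, l)%:R * g l)) //.
  rewrite big_mkcond /=.
  over.
under eq_bigr => j _.
  rewrite mulr_sumr.
  under eq_bigr => l _.
    have -> : (-1) ^+ j * 'C(i, j)%:R * (if (l < j.+1)%N then
      (-1) ^+ l * 'C(j, l)%:R * g l else 0)
      = 'C(j, l)%:R * ((-1) ^+ j * 'C(i, j)%:R * ((-1) ^+ l * g l)).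
      case: ltnP => [_|lt_jl]; first by ring.
      by rewrite (bin_small lt_jl) mulr0 mul0r.
    over.
  over.
rewrite exchange_big /=.
have term (l : 'I_i.+1) : \sum_(j < i.+1)
    'C(j, l)%:R * ((-1) ^+ j * 'C(i, j)%:R * ((-1) ^+ l * g l))
  = 'C(i, l)%:R * g l * (i - l == 0)%N%:R.
  rewrite (@sum_bin_shift i l (fun j => (-1) ^+ j * 'C(i, j)%:R * ((-1) ^+ l * g l))) ?leq_ord //.
  rewrite -sum_sign_bin mulr_sumr; apply: eq_bigr => s _.
  transitivity ((('C(i, l + s) * 'C(l + s, l))%N)%:R * (-1) ^+ s
    * g l * ((-1) ^+ l * (-1) ^+ l) : K); first by rewrite natrM exprD; ring.
  by rewrite bin_trinomial ?leq_ord // natrM -expr2 sqrr_sign; ring.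
rewrite (eq_bigr _ (fun l _ => term l)) big_ord_recr /= subnn eqxx binn.
rewrite big1 ?add0r ?mul1r ?mulr1 // => l _.
by rewrite subn_eq0 leqNgt ltn_ord mulr0.
Qed.

(* Expanding [g] in binomial coefficients reduces the sum to Chu-Vandermonde. *)
Lemma altdiff_poch_ratio g a c n : poch c n != 0 ->
  altdiff (fun i => poch a i / poch c i * g i) n
  = (poch c n)^-1 * \sum_(k < n.+1)
      'C(n, k)%:R * poch a k * poch (c - a) (n - k) * altdiff g k.
Proof.
move=> nz_c; rewrite {1}/altdiff.
under eq_bigr => i _ do
  rewrite (altdiff_inv g _ _ (leq_ord i)) !mulr_sumr.
rewrite exchange_big mulr_sumr /=; apply: eq_bigr => k _.
pose F i := (-1) ^+ i * 'C(n, i)%:R * (poch a i / poch c i)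
  * ((-1) ^+ k * altdiff g k).
rewrite (eq_bigr (fun i : 'I_n.+1 => 'C(i, k)%:R * F i)); last first.
  by move=> i _; rewrite /F; ring.
rewrite sum_bin_shift ?leq_ord //.
(* A common shift by [k] preserves [c - a]: the inner sum is Chu-Vandermonde of order [n - k] at
   [(a + k, c + k)]. *)
have -> : c - a = c + k%:R - (a + k%:R) by ring.
rewrite /F {F}; move: (altdiff g k) => D.
rewrite -chu_vandermonde [in RHS]mulr_sumr mulr_suml mulr_sumr.
apply: eq_bigr => s _.
have le_ks : (k + s <= n)%N by rewrite -leq_subRL ?leq_ord.
have nz_ks := poch_neq0_le _ _ _ le_ks nz_c.
have -> : poch (c + k%:R + s%:R) (n - k - s) = poch c n / poch c (k + s).
  apply: (canRL (mulfK nz_ks)).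
  by rewrite -subnDA -addrA -natrD mulrC -pochD subnKC.
transitivity ((('C(n, k + s) * 'C(k + s, k))%N)%:R * ((-1) ^+ k * (-1) ^+ k)
  * ((-1) ^+ s * poch a (k + s) / poch c (k + s) * D)).
  by rewrite natrM exprD; ring.
rewrite bin_trinomial ?leq_ord // natrM -expr2 sqrr_sign pochD.
by field; rewrite nz_c nz_ks.
Qed.

(** Write the polynomial as $pX+c$. The constant is killed by the alternating row sum, and
    $i\binom{n+1}{i}=(n+1)\binom{n}{i-1}$ turns the rest into a difference of order [n] of $p(X+1)$,
    of lower degree. *)
Lemma altdiff_poly_eq0 p n : (size p <= n)%N ->
  altdiff (fun i => p.[i%:R]) n = 0.
Proof.
elim: n p => [|n IH] p.
  by rewrite leqn0 size_poly_eq0 => /eqP->; rewrite /altdiff big_ord1 horner0 mulr0.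
elim/poly_ind: p => [|p c _] sz; first by rewrite /altdiff big1 // => i _; rewrite horner0 mulr0.
have {}sz : (size p <= n)%N.
  move: sz; rewrite size_MXaddC; case: ifP => //= /andP[/eqP-> _].
  by rewrite size_poly0.
have -> : altdiff (fun i => (p * 'X + c%:P).[i%:R]) n.+1
  = - n.+1%:R * altdiff (fun i => (p \Po ('X + 1%:P)).[i%:R]) n.
  rewrite /altdiff.
  under eq_bigr => i _ do rewrite hornerMXaddC mulrDr.
  rewrite big_split /= -mulr_suml sum_sign_bin mul0r addr0.
  rewrite big_ord_recl /= !mulr0 add0r mulr_sumr; apply: eq_bigr => i _.
  rewrite /bump add1n horner_comp hornerD hornerX hornerC natr1.
  transitivity ((-1) ^+ i.+1 * ((i.+1 * 'C(n.+1, i.+1))%N)%:R * p.[i.+1%:R]).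
    by rewrite natrM; ring.
  by rewrite -mul_bin_diag natrM exprS; ring.
by rewrite IH ?mulr0 // size_comp_poly2 // size_XaddC.
Qed.

End AlternatingDifferences.

Arguments altdiff {K} g n.

(** * The ratio $P(i)$ as a polynomial in $i$, and the coefficients $C_k$ *)

Section Coefficients.
Variables (K : numFieldType) (r : nat) (f : 'I_r -> K) (mv : 'I_r -> nat).
Implicit Types (b d e z : K) (i j k m n q : nat).

Definition fratio i : K :=
  \prod_(x <- fmseq f mv) poch x i / \prod_(y <- fseq f) poch y i.

Lemma hypF_altdiff n (a c : seq K) : hypF n a c =
  altdiff (fun i => \prod_(x <- a) poch x i / \prod_(y <- c) poch y i) n.
Proof.
apply: eq_bigr => i _; rewrite /hypterm big_cons -poch_opp_nat_bin.
by rewrite invfM; ring.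
Qed.

Lemma Ccoef_altdiff k : Ccoef f mv k = (-1) ^+ k / (k`!)%:R * altdiff fratio k.
Proof. by rewrite /Ccoef hypF_altdiff. Qed.

Lemma size_prod_le_sum (I : Type) (s : seq I) (F : I -> {poly K}) (N : I -> nat) :
  (forall x, (size (F x) <= (N x).+1)%N) ->
  (size (\prod_(x <- s) F x)%R <= (\sum_(x <- s) N x).+1)%N.
Proof.
move=> leFN; elim/big_rec2: _ => [|x u p _ le_pu]; first by rewrite size_poly1.
apply: leq_trans (size_polyMleq _ _) _.
have := leq_add (leFN x) le_pu; rewrite addSn addnS -addnS.
by case: (_ + _)%N.
Qed.

(** From $(f)_m(f+m)_i=(f)_{m+i}=(f)_i(f+i)_m$, each factor equals $(f+i)_m/(f)_m$, of degree $m$ in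
    $i$. *)
Lemma fratio_poly : (forall (j : 'I_r) i, f j != - i%:R) ->
  exists2 p : {poly K}, (size p <= (\sum_(j < r) mv j).+1)%N
    & forall i, fratio i = p.[i%:R].
Proof.
move=> hf.
pose F (j : 'I_r) := (poch (f j) (mv j))^-1%:P * \prod_(l < mv j) ('X + (f j + l%:R)%:P).
exists (\prod_(j < r) F j) => [|i].
  apply: size_prod_le_sum => j; rewrite /F mul_polyC.
  apply: leq_trans (size_scale_leq _ _) _.
  rewrite -[X in (_ <= X.+1)%N]card_ord -sum1_card.
  by apply: size_prod_le_sum => l; rewrite size_XaddC.
rewrite /fratio big_map big_enum big_map big_enum /= horner_prod -prodf_div.
apply: eq_bigr => j _; rewrite hornerM hornerC horner_prod.
have hz := poch_neq0 _ _ (hf j).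
apply: (canLR (mulfK (hz i))); rewrite -mulrA.
apply: (canRL (mulKf (hz (mv j)))).
rewrite -pochD addnC pochD mulrC; congr (_ * _).
by apply: eq_bigr => l _; rewrite hornerD hornerX hornerC; ring.
Qed.

Lemma Ccoef_eq0 k : (forall (j : 'I_r) i, f j != - i%:R) ->
  (\sum_(j < r) mv j < k)%N -> Ccoef f mv k = 0.
Proof.
move=> hf lt_k; rewrite Ccoef_altdiff; have [p sz pE] := fratio_poly hf.
rewrite (_ : altdiff _ _ = altdiff (fun i => p.[i%:R]) k); last first.
  by apply: eq_bigr => i _; rewrite pE.
by rewrite altdiff_poly_eq0 ?mulr0 // (leq_trans sz).
Qed.

(* The numerator of the [j]-th alternating difference of
   [(b)_i / (b + p)_i * fratio i]; it equals [(-q)_j Q_m^0(-j)] for [j <= q]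
   and [j! / (m-q-1)! R_{m-q-1}(-j)] for [j > q], where [p = m - q]. *)
Definition Wsum b p j : K := \sum_(k < j.+1)
  'C(j, k)%:R * poch b k * poch (p%:R) (j - k) * altdiff fratio k.

(** [altdiff_poch_ratio] is used twice: with [(d, e)] outside, then with [(b, b + p)], where the
    difference of parameters is [p]. *)
Lemma hypF_Wsum b d e p n : (forall i, b + p%:R != - i%:R) -> poch e n != 0 ->
  hypF n [:: b, d & fmseq f mv] [:: b + p%:R, e & fseq f]
  = \sum_(j < n.+1) (poch e n)^-1 * ('C(n, j)%:R * poch d j
      * poch (e - d) (n - j) * (Wsum b p j / poch (b + p%:R) j)).
Proof.
move=> hb he; rewrite hypF_altdiff -mulr_sumr.
rewrite (_ : altdiff _ _ = altdiff (fun i => poch d i / poch e i *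
  (poch b i / poch (b + p%:R) i * fratio i)) n); last first.
  apply: eq_bigr => i _; congr (_ * _); rewrite !big_cons /fratio !invfM; ring.
rewrite altdiff_poch_ratio //; congr (_ * _); apply: eq_bigr => j _.
rewrite altdiff_poch_ratio ?poch_neq0 //.
by rewrite (_ : b + p%:R - b = p%:R) 1?(mulrC (_^-1)) //; ring.
Qed.

(** * Evaluation of [Wsum] through $Q_m^0$ for $j\le q$ and through $R_{m-q-1}$ for $j>q$ *)

Lemma Wsum_Q0val b m q j : (j <= q)%N ->
  poch (- q%:R) j * Q0val f mv b m q j = Wsum b (m - q) j.
Proof.
move=> le_jq; rewrite /Q0val mulVKf ?poch_opp_nat_neq0 //.
apply: eq_bigr => k _; rewrite Ccoef_altdiff.
transitivity (poch b k * ((-1) ^+ k * (poch (- j%:R) k / k`!%:R))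
   * altdiff fratio k * poch (m - q)%:R (j - k)); first by ring.
by rewrite poch_opp_nat_bin signrMK; ring.
Qed.

Lemma horner_poch (p : {poly K}) x k : (poch p k).[x] = poch p.[x] k.
Proof.
by rewrite horner_prod; apply: eq_bigr => i _; rewrite hornerD -polyC_natr hornerC.
Qed.

Lemma horner_Rpoly b m q x : (Rpoly f mv b m q).[x] = \sum_(k < m.+1)
  poch b k * Ccoef f mv k * (-1) ^+ k * poch (1 - x - k%:R) (m - q - 1).
Proof.
rewrite horner_sum; apply: eq_bigr => k _.
by rewrite hornerZ horner_poch !hornerE -polyC_natr hornerC.
Qed.

Lemma sum_ord_trunc (F : nat -> K) a c : (a <= c)%N ->
  (forall k, (a <= k < c)%N -> F k = 0) -> \sum_(k < c) F k = \sum_(k < a) F k.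
Proof.
move=> le_ac F0; rewrite (big_ord_widen c F le_ac) [RHS]big_mkcond /=.
by apply: eq_bigr => k _; case: ltnP => // le_ak; rewrite F0 ?le_ak /=.
Qed.

(** The base is the nonpositive integer $-(k-j-1)$ with $k-j-1<m-q-1$, so the product meets a zero
    factor. *)
Lemma Rpoly_term_eq0 m q j k : (q < j < k)%N -> (k <= m)%N ->
  poch (1 - - j%:R - k%:R : K) (m - q - 1) = 0.
Proof.
case/andP=> lt_qj lt_jk le_km.
have -> : 1 - - j%:R - k%:R = - (k - j.+1)%:R :> K.
  by rewrite natrB // -(natr1 j); ring.
by rewrite poch_opp_nat //; lia.
Qed.

Lemma Wsum_Rpoly b m q j : (forall (j : 'I_r) i, f j != - i%:R) ->
  m = (\sum_(j < r) mv j)%N -> (q < m)%N -> (q < j)%N ->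
  Wsum b (m - q) j
  = (j`!)%:R / ((m - q - 1)`!)%:R * (Rpoly f mv b m q).[- j%:R].
Proof.
move=> hf hm lt_qm lt_qj; rewrite horner_Rpoly.
pose F k := poch b k * Ccoef f mv k * (-1) ^+ k
  * poch (1 - - j%:R - k%:R) (m - q - 1).
have -> : \sum_(k < m.+1) F k = \sum_(k < j.+1) F k.
  (* For [j <= m] the terms of $R$ with [k > j] vanish; for [m < j] the terms added beyond [m]
     vanish since $C_k=0$ there. *)
  have [le_jm|lt_mj] := leqP j m.
    apply: sum_ord_trunc => // k /andP[lt_jk le_km].
    by rewrite /F Rpoly_term_eq0 ?mulr0 ?lt_qj.
  apply/esym/sum_ord_trunc; first exact: leqW.
  by move=> k /andP[lt_mk _]; rewrite /F Ccoef_eq0 -?hm // mulr0 !mul0r.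
rewrite mulr_sumr; apply: eq_bigr => k _; rewrite /F Ccoef_altdiff.
have le_kj := leq_ord k.
have -> : 1 - - j%:R - k%:R = (j - k).+1%:R :> K.
  by rewrite -natr1 natrB //; ring.
have -> : (m - q = (m - q - 1).+1)%N by lia.
rewrite subSS subn0; move: (m - q - 1)%N => s.
(* With $s=m-q-1$, both Pochhammer symbols come from the same factorial $(s+j-k)!$. *)
have E : 'C(j, k)%:R * poch s.+1%:R (j - k)
  = j`!%:R / s`!%:R / k`!%:R * poch (j - k).+1%:R s :> K.
  have := poch_natS K s (j - k); have := poch_natS K (j - k) s.
  rewrite addnC => <- /(canRL (mulKf (factn_neq0 K _))) ->.
  rewrite -(bin_fact le_kj) !natrM.
  by field; rewrite !factn_neq0.
transitivity (j`!%:R / s`!%:R / k`!%:R * poch (j - k).+1%:R s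
  * (poch b k * altdiff fratio k)); first by rewrite -E; ring.
rewrite -[altdiff fratio k in LHS](signrMK k); ring.
Qed.

(** * Term-by-term comparison with the right-hand side, for $j\le q$ and then $j=q+1+s$ *)

Lemma Wsum_term_head b d e m n q j : (j <= q)%N -> (j <= n)%N ->
  poch (1 + d - e - n%:R) j != 0 ->
  poch (e - d) n / poch e n *
    (poch (- n%:R) j * poch (- q%:R) j * poch d j * Q0val f mv b m q j
     / (poch (b + (m - q)%:R) j * poch (1 + d - e - n%:R) j * (j`!)%:R))
  = (poch e n)^-1 * ('C(n, j)%:R * poch d j * poch (e - d) (n - j)
      * (Wsum b (m - q) j / poch (b + (m - q)%:R) j)).
Proof.
move=> le_jq le_jn nz.
have dE : 1 + d - e - n%:R = 1 - (e - d) - n%:R by ring.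
rewrite (poch_sub _ _ _ _ le_jn) -dE // -Wsum_Q0val //.
transitivity ((poch e n)^-1 * (poch (- n%:R) j / (j`!)%:R * poch d j
  * (poch (e - d) n / poch (1 + d - e - n%:R) j)
  * (poch (- q%:R) j * Q0val f mv b m q j / poch (b + (m - q)%:R) j))).
  by rewrite !invfM; ring.
by rewrite poch_opp_nat_bin; ring.
Qed.

(** Per root, the factor at $-(q+1+s)$ is the one at $-q-1$ times $(\lambda+q+2)_s/(\lambda+q+1)_s$,
    because the quotient telescopes. There is no division by $R(-q-1)$, which may be zero when
    [s = 0]. *)
Lemma Rpoly_ratio b m q s kappa (lambda : seq K) :
  Rpoly f mv b m q = kappa *: \prod_(x <- lambda) ('X - x%:P) ->
  (forall x, x \in lambda -> poch (x + q%:R + 1) s != 0) ->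
  (Rpoly f mv b m q).[- (q.+1 + s)%:R] = (Rpoly f mv b m q).[- q%:R - 1]
    * (\prod_(x <- [seq x + q%:R + 2 | x <- lambda]) poch x s
       / \prod_(x <- [seq x + q%:R + 1 | x <- lambda]) poch x s).
Proof.
move=> -> hlam; rewrite !hornerZ !horner_prod !big_map -mulrA; congr (_ * _).
rewrite -prodf_div -big_split /= big_seq [RHS]big_seq; apply: eq_bigr => x xl.
rewrite mulrA; apply: (canRL (mulfK (hlam x xl))) => /=.
rewrite !hornerXsubC natrD -(natr1 q).
have := pochSl _ (x + q%:R + 1) s; rewrite pochS.
have -> : x + q%:R + 2 = x + q%:R + 1 + 1 by ring.
have -> : - q%:R - 1 - x = - (x + q%:R + 1) by ring.
by rewrite mulNr => <-; ring.
Qed.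

(** Each Pochhammer symbol is split after its first [q + 1] factors. The [j!] from [Wsum_Rpoly]
    cancels the one in the binomial, and the upper parameter [1] cancels the [s!] of the series. *)
Lemma Wsum_term_tail b d e m n q s kappa (lambda : seq K) :
  (forall (l : 'I_r) i, f l != - i%:R) -> m = (\sum_(l < r) mv l)%N ->
  (q < m)%N -> (q.+1 + s <= n)%N ->
  (forall i, b + (m - q)%:R != - i%:R) ->
  poch (2 + d + q%:R - e - n%:R) s != 0 ->
  Rpoly f mv b m q = kappa *: \prod_(x <- lambda) ('X - x%:P) ->
  (forall x, x \in lambda -> poch (x + q%:R + 1) s != 0) ->
  (poch e n)^-1 * ('C(n, q.+1 + s)%:R * poch d (q.+1 + s)
    * poch (e - d) (n - (q.+1 + s))
    * (Wsum b (m - q) (q.+1 + s) / poch (b + (m - q)%:R) (q.+1 + s)))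
  = (-1) ^+ (q + 1) * poch (- n%:R) (q + 1) * poch d (q + 1)
    * poch (e - d) (n - q - 1) * (Rpoly f mv b m q).[- q%:R - 1]
    / (poch (b + (m - q)%:R) (q + 1) * poch e n * ((m - q - 1)`!)%:R)
    * hypterm (- (n - q - 1)%:R
        :: [:: 1, d + q%:R + 1 & [seq x + q%:R + 2 | x <- lambda]])
        [:: b + m%:R + 1, 2 + d + q%:R - e - n%:R
          & [seq x + q%:R + 1 | x <- lambda]] s.
Proof.
move=> hf hm lt_qm le_n hb hde hR hlam.
rewrite Wsum_Rpoly ?ltn_addr // (Rpoly_ratio _ _ _ _ _ _ hR hlam).
have nE : (n - q - 1)%:R = n%:R - q%:R - 1 :> K by rewrite !natrB //; lia.
have le_s : (s <= n - q - 1)%N by lia.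
have dE : 2 + d + q%:R - e - n%:R = 1 - (e - d) - (n - q - 1)%:R.
  by rewrite nE; ring.
have -> : (n - (q.+1 + s) = n - q - 1 - s)%N by lia.
rewrite (poch_sub _ _ _ _ le_s) -dE //.
have -> : poch (b + (m - q)%:R) (q.+1 + s)
    = poch (b + (m - q)%:R) (q + 1) * poch (b + m%:R + 1) s.
  rewrite pochD addn1; congr (_ * poch _ _).
  by rewrite natrB 1?ltnW // -(natr1 q); ring.
have -> : poch d (q.+1 + s) = poch d (q + 1) * poch (d + q%:R + 1) s.
  by rewrite pochD addn1 -(natr1 q) addrA.
have binE : 'C(n, q.+1 + s)%:R = (-1) ^+ (q + 1 + s)
    * (poch (- n%:R) (q + 1) * poch (- (n - q - 1)%:R) s) / (q.+1 + s)`!%:R :> K.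
  rewrite (_ : - (n - q - 1)%:R = - n%:R + (q + 1)%:R); last first.
    by rewrite nE natrD; ring.
  by rewrite -pochD -mulrA addn1 poch_opp_nat_bin signrMK.
have fact1 : poch 1 s = s`!%:R :> K.
  by have := poch_natS K 0 s; rewrite mul1r add0n.
rewrite binE /hypterm !big_cons fact1 !invfM.
(* Both inverses occur unchanged on the two sides, so they are made opaque for [field]. *)
move: (\prod_(y <- _) poch y s)^-1 (poch e n)^-1 => L E.
(* $b+m+1+i$ is $b+(m-q)$ shifted by $q+1+i$. *)
have hb1 : poch (b + m%:R + 1) s != 0.
  apply: poch_neq0 => i; apply: contraNneq (hb (q.+1 + i)%N) => bE.
  by rewrite natrD opprD -bE -natr1 natrB 1?ltnW //; apply/eqP; ring.
(* The signs $(-1)^s$ from the binomial and from the reversal in [poch_sub] cancel through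
   $x^2=1$. *)
have := sqrr_sign K s; rewrite exprD; move: ((-1) ^+ s) => x xE.
field: xE; rewrite ?hde ?hb1 ?factn_neq0 ?poch_neq0 //.
Qed.

End Coefficients.

Theorem theorem5 (R : realType) (b d e : R[i]) (r : nat) (mv : 'I_r -> nat)
    (m : nat) (f : 'I_r -> R[i]) (q n : nat)
    (kappa : R[i]) (lambda : (m - q - 1).-tuple R[i])
    (hr : (0 < r)%N) (hmv : forall j, (0 < mv j)%N)
    (hm : m = (\sum_(j < r) mv j)%N)
    (hq : (q < m)%N) (hn : (0 < n)%N)
    (hb : forall i : nat, b + (m - q)%:R != - i%:R)
    (hfb : forall (j : 'I_r) (i : int),
       m%:Z - q%:Z - (mv j)%:Z <= i -> i <= 0 -> f j - b != i%:~R)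
    (* lambda lists the roots of R_{m-q-1}, which has degree m - q - 1 *)
    (hkappa : kappa != 0)
    (hlambda : Rpoly f mv b m q = kappa *: \prod_(x <- lambda) ('X - x%:P))
    (* no denominator occurring in the finite sums vanishes *)
    (hf : forall (j : 'I_r) (i : nat), f j != - i%:R)
    (he : poch e n != 0)
    (hde1 : poch (1 + d - e - n%:R) (minn n q) != 0)
    (hde2 : poch (2 + d + q%:R - e - n%:R) (n - q - 1) != 0)
    (hlam : forall x, x \in lambda -> poch (x + q%:R + 1) (n - q - 1) != 0) :
  hypF n [:: b, d & fmseq f mv] [:: b + (m - q)%:R, e & fseq f]
  = poch (e - d) n / poch e n
    * (\sum_(j < q.+1)
         poch (- n%:R) j * poch (- q%:R) j * poch d j * Q0val f mv b m q j
         / (poch (b + (m - q)%:R) j * poch (1 + d - e - n%:R) j * (j`!)%:R))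
    + (if (n <= q)%N then 0 else
       (-1) ^+ (q + 1) * poch (- n%:R) (q + 1) * poch d (q + 1)
       * poch (e - d) (n - q - 1) * (Rpoly f mv b m q).[- q%:R - 1]
       / (poch (b + (m - q)%:R) (q + 1) * poch e n * ((m - q - 1)`!)%:R)
       * hypF (n - q - 1)
           [:: 1, d + q%:R + 1 & [seq x + q%:R + 2 | x <- lambda]]
           [:: b + m%:R + 1, 2 + d + q%:R - e - n%:R
             & [seq x + q%:R + 1 | x <- lambda]])
  /\
  (Rpoly f mv b m q).[- q%:R - 1]
  = (-1) ^+ (m - q + 1)
    * \sum_(k < q.+2)
        poch b k * Ccoef f mv k * (-1) ^+ k * poch (k%:R - m%:R) (m - q - 1).
Proof.
split; last first.
  rewrite horner_Rpoly.
  have le_qm : (q.+2 <= m.+1)%N by [].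
  have -> : - q%:R - 1 = - q.+1%:R :> R[i] by rewrite -natr1; ring.
  (* At $t=-(q+1)$ the terms with [k > q + 1] vanish; reflecting the others yields
     $(k-m)_{m-q-1}$. *)
  rewrite (sum_ord_trunc _ (fun k => poch b k * Ccoef f mv k * (-1) ^+ k
    * poch (1 - - q.+1%:R - k%:R) (m - q - 1)) _ _ le_qm); last first.
    by move=> k /andP[lt_qk le_km]; rewrite Rpoly_term_eq0 ?mulr0 // ltnSn.
  rewrite mulr_sumr; apply: eq_bigr => k _; rewrite (poch_reflect _ (1 - _ - _)).
  have -> : 1 - (1 - - q.+1%:R - k%:R) - (m - q - 1)%:R = k%:R - m%:R :> R[i].
    by rewrite -(natr1 q) !natrB //; [ring | exact: ltnW | rewrite subn_gt0].
  (* The reflection sign has exponent [m - q - 1], of the same parity as [m - q + 1]. *)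
  rewrite (_ : (m - q + 1 = (m - q - 1).+2)%N); last by lia.
  by rewrite !exprS; ring.
rewrite hypF_Wsum //; case: leqP => [le_nq|lt_qn].
  rewrite addr0.
  pose F j := poch (- n%:R) j * poch (- q%:R) j * poch d j * Q0val f mv b m q j
    / (poch (b + (m - q)%:R) j * poch (1 + d - e - n%:R) j * (j`!)%:R).
  (* For [n < j] the factor $(-n)_j$ is zero, so the head sum already stops at [n]. *)
  rewrite (sum_ord_trunc _ F n.+1) //; last first.
    by move=> j /andP[lt_nj _]; rewrite /F poch_opp_nat // !mul0r.
  rewrite mulr_sumr; apply: eq_bigr => j _.
  rewrite Wsum_term_head ?leq_ord //; first exact: leq_trans (leq_ord j) le_nq.
  by apply: poch_neq0_le hde1; rewrite (minn_idPl le_nq) leq_ord.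
pose T j := (poch e n)^-1 * ('C(n, j)%:R * poch d j * poch (e - d) (n - j)
  * (Wsum _ _ f mv b (m - q) j / poch (b + (m - q)%:R) j)).
(* The indices [0..n] split into [0..q] and [q + 1 + s] with [s <= n - q - 1]. *)
have nE : (n.+1 = q.+1 + (n - q - 1).+1)%N by lia.
rewrite -[LHS]/(\sum_(j < n.+1) T j) nE big_split_ord; congr (_ + _).
  rewrite mulr_sumr; apply: eq_bigr => j _.
  have le_jq := leq_ord j.
  rewrite Wsum_term_head //; first exact: leq_trans le_jq (ltnW lt_qn).
  by apply: poch_neq0_le hde1; rewrite (minn_idPr (ltnW lt_qn)).
rewrite mulr_sumr; apply: eq_bigr => s _.
have le_s := leq_ord s.
apply: Wsum_term_tail hlambda _ => //; first by lia.
  exact: poch_neq0_le hde2.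
by move=> x xl; apply: poch_neq0_le (hlam x xl).
Qed.
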